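(* Let $M$ be a complex linear operator of size $n$. The following are equivalent. (a) $M$ is antidiagonalizable. (b) $M$ can be expressed as a direct sum of traceless $2\times2$ matrices, with the exception of a single $1\times1$ matrix as an additional summand for odd $n$. (c) $M$ has a symmetric spectrum for even $n$ and a c-symmetric spectrum for odd $n$, whereby the only generalized eigenvectors of rank $\neq1$ are of rank $2$ with eigenvalues of $0$. (d) $M$ can be expressed as a direct sum of a nilpotent matrix where every generalized eigenvector is of rank $2$ and a diagonalizable matrix with a symmetric spectrum if $n$ is even and a c-symmetric spectrum if $n$ is odd. (e) The Jordan canonical form of $M$, up to a permutation of Jordan blocks, is the direct sum of some number $s\ge0$ of blocks $\begin{pmatrix}0&1\\0&0\end{pmatrix}$ and a diagonal matrix of the form $\mathrm{diag}(\lambda_1,\dots,\lambda_r,-\lambda_r,\dots,-\lambda_1)$ if $n=2s+2r$ is even, or $\mathrm{diag}(\lambda_1,\dots,\lambda_r,c,-\lambda_r,\dots,-\lambda_1)$ if $n=2s+2r+1$ is odd, with $\lambda_i,c\in\mathbb C$. (f) $M$ is similar to $\mathfrak N\oplus\mathfrak D$, where $\mathfrak N$ is a direct sum of copies of $\begin{pmatrix}0&1\\0&0\end{pmatrix}$ and $\mathfrak D$ is a direct sum of matrices of the form $\lambda\begin{pmatrix}1&0\\0&-1\end{pmatrix}$ with $\lambda\in\mathbb C$, together with one additional $1\times1$ summand $(c)$, $c\in\mathbb C$, if $n$ is odd.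
   Context: Linear operators are identified with square matrices up to similarity, so ''can be expressed as'' a matrix means being similar to it. A matrix is antidiagonal if its only nonzero entries are at positions $(i,n+1-i)$, and antidiagonalizable if it is similar to an antidiagonal matrix. The spectrum is the multiset of eigenvalues with algebraic multiplicity. It is symmetric if it is invariant, with multiplicities, under multiplication by $-1$. The spectrum $\mathcal S$ of a matrix of odd size is c-symmetric if there is $c\in\mathcal S$ such that $\mathcal S\setminus\{c\}$ (one copy removed) is symmetric. A vector $x$ is a generalized eigenvector of rank $r$ of $M$ for the eigenvalue $\lambda$ if $(M-\lambda I)^rx=0$ but $(M-\lambda I)^{r-1}x\ne0$.
   Formalization: In (d), ''every generalized eigenvector is of rank 2'' is read as ''every generalized eigenvector of rank ≠1 is of rank 2'', since a nonempty nilpotent matrix always has rank-1 eigenvectors; read literally, (d) fails for the antidiagonal matrix with rows (0,1),(0,0). *)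

(* Defs.v *)
From HB Require Import structures.
From mathcomp Require Import all_boot all_order all_algebra.
From mathcomp Require Export complex reals.

Set Implicit Arguments.
Unset Strict Implicit.
Unset Printing Implicit Defensive.

Import GRing.Theory.
Local Open Scope ring_scope.

(* The sizes of A and B may be equal without being convertible, e.g. when B is
   a block diagonal matrix, hence the cast. *)
Definition similar_mx (F : fieldType) (m n : nat)
    (A : 'M[F]_m) (B : 'M[F]_n) : Prop :=
  exists e : n = m, A ~_{in unitmx} (castmx (e, e) B).

Definition dirsum (F : fieldType) (m n : nat)
    (A : 'M[F]_m) (B : 'M[F]_n) : 'M[F]_(m + n) :=
  block_mx A 0 0 B.

(* Positions (i, n + 1 - i) in 1-based indexing are (i, rev_ord i) here. *)
Definition antidiagonal_mx (F : fieldType) (n : nat) (A : 'M[F]_n) : Prop :=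
  forall i j : 'I_n, A i j != 0 -> j = rev_ord i.

Definition antidiagonalizable (F : fieldType) (n : nat) (M : 'M[F]_n) : Prop :=
  exists A : 'M[F]_n, antidiagonal_mx A /\ similar_mx M A.

(* The sequence lists each eigenvalue according to its algebraic multiplicity;
   its order is unspecified, so it is only meaningful up to perm_eq. *)
Definition spectrum (F : closedFieldType) (n : nat) (M : 'M[F]_n) : seq F :=
  sval (closed_field_poly_normal (char_poly M)).

Lemma spectrumE (F : closedFieldType) (n : nat) (M : 'M[F]_n) :
  char_poly M = \prod_(z <- spectrum M) ('X - z%:P).
Proof.
rewrite /spectrum; case: closed_field_poly_normal => s /= {1}->.
by rewrite (monicP (char_poly_monic M)) scale1r.
Qed.

Definition symmetric_spectrum (F : fieldType) (s : seq F) : Prop :=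
  perm_eq [seq - z | z <- s] s.

Definition c_symmetric_spectrum (F : fieldType) (s : seq F) : Prop :=
  odd (size s) /\ exists2 c : F, c \in s & symmetric_spectrum (rem c s).

Definition gen_eigenvector (F : fieldType) (n : nat)
    (M : 'M[F]_n) (z : F) (r : nat) (x : 'cV[F]_n) : Prop :=
  [/\ (0 < r)%N, (M - z%:M) ^+ r *m x = 0 & (M - z%:M) ^+ r.-1 *m x != 0].

Definition nilpotent_mx (F : fieldType) (n : nat) (N : 'M[F]_n) : Prop :=
  exists k : nat, N ^+ k = 0.

Definition jordan_block (F : fieldType) (k : nat) (z : F) : 'M[F]_k :=
  \matrix_(i, j) (if j == i then z else if j == i.+1 :> nat then 1 else 0).

(* A pair (k, z) in L stands for the Jordan block of size k and eigenvalue z. *)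
Definition jordan_mx (F : fieldType) (L : seq (nat * F)) :=
  \mxdiag_(i < size L)
    jordan_block (tnth (in_tuple L) i).1 (tnth (in_tuple L) i).2.

Definition jordan_form_of (F : fieldType) (n : nat)
    (M : 'M[F]_n) (L : seq (nat * F)) : Prop :=
  all (fun b => 0 < b.1)%N L /\ similar_mx M (jordan_mx L).

(* Main.v *)
(* An antidiagonal matrix pairs the i-th basis vector with the i-th from the
   end, hence it is a permuted direct sum of 2x2 blocks with zero diagonal, and
   of a 1x1 block in odd size. A traceless 2x2 block B satisfies B^2 = -det B,
   so it has eigenvalues z and -z, and no generalized eigenvector of rank 2
   unless z = 0. Conversely, if M satisfies (c), then M^2 q(M) = 0 for some q
   with distinct nonzero roots. As long as M q(M) != 0, a nilpotent Jordan block
   of size 2 can be split off; once M q(M) = 0, what remains is diagonalizable.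
   Removing such blocks preserves the (c-)symmetry of the spectrum, so the
   eigenvalues of the diagonalizable part can be matched in pairs z, -z, and
   diag(z, -z) is similar to the antidiagonal matrix with both entries z. *)

Require Import Defs.
From HB Require Import structures.
From mathcomp Require Import all_boot all_order all_algebra.
From mathcomp Require Import zify ring.

Set Implicit Arguments.
Unset Strict Implicit.
Unset Printing Implicit Defensive.

Import GRing.Theory Num.Theory.
Local Open Scope ring_scope.

(** * Similarity of matrices with possibly different sizes *)

Section Similarity.
Variable F : fieldType.

(* Unlike [similar_mx], this relation needs no cast: the equality of the sizes
   is a consequence of the existence of a two-sided inverse. *)
Definition hsim m n (A : 'M[F]_m) (B : 'M[F]_n) : Prop :=
  exists (P : 'M_(m, n)) (Q : 'M_(n, m)),
    [/\ P *m Q = 1%:M, Q *m P = 1%:M & A *m P = P *m B].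

Lemma hsim_size m n (A : 'M_m) (B : 'M_n) : hsim A B -> m = n.
Proof.
case=> P [Q [PQ QP _]]; apply/eqP.
by rewrite eqn_leq (mulmx1_min PQ) (mulmx1_min QP).
Qed.

Lemma hsim_refl n (A : 'M_n) : hsim A A.
Proof. by exists 1%:M, 1%:M; rewrite !mulmx1 mul1mx. Qed.

Lemma eq_hsim n (A B : 'M_n) : A = B -> hsim A B.
Proof. by move->; apply: hsim_refl. Qed.

Lemma hsim_sym m n (A : 'M_m) (B : 'M_n) : hsim A B -> hsim B A.
Proof.
case=> P [Q [PQ QP APB]]; exists Q, P; split=> //.
by rewrite -[RHS]mulmx1 -PQ !mulmxA -[Q *m A *m P]mulmxA APB !mulmxA QP mul1mx.
Qed.

Lemma hsim_trans m n p (B : 'M_n) (A : 'M_m) (C : 'M_p) :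
  hsim A B -> hsim B C -> hsim A C.
Proof.
case=> P [Q [PQ QP APB]] [P' [Q' [PQ' QP' BPC]]].
exists (P *m P'), (Q' *m Q); split.
- by rewrite mulmxA -(mulmxA P) PQ' mulmx1.
- by rewrite mulmxA -(mulmxA Q') QP mulmx1.
- by rewrite mulmxA APB -!mulmxA BPC.
Qed.

Lemma hsim_castmx m n (e : m = n) (A : 'M_m) : hsim (castmx (e, e) A) A.
Proof. by case: n / e; rewrite castmx_id; apply: hsim_refl. Qed.

(** The bridge between the cast-based relation of the statement and [hsim], in which the
    constructions below are carried out. *)
Lemma similar_mxP m n (A : 'M_m) (B : 'M_n) : similar_mx A B <-> hsim A B.
Proof.
split=> [[e [P Pu /(simmxP Pu) PAB]]|AB].
  apply: hsim_trans (hsim_castmx e B).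
  exists (invmx P), P; rewrite mulmxV ?mulVmx //; split=> //.
  by rewrite -[LHS](mulKmx Pu) (mulmxA P) PAB mulmxK.
exists (esym (hsim_size AB)).
(* The similarity is taken from [B] to [A] because [simmxP] expects the conjugating matrix to the
   left of [A]. *)
have [P [Q [PQ QP QAB]]]:
    hsim (castmx (esym (hsim_size AB), esym (hsim_size AB)) B) A.
  exact: hsim_trans (hsim_castmx _ B) (hsim_sym AB).
have [Pu _] := mulmx1_unit PQ; exists P => //; exact/(simmxP Pu).
Qed.

Lemma hsim_dirsum m n m' n' (A : 'M_m) (B : 'M_n) (A' : 'M_m') (B' : 'M_n') :
  hsim A A' -> hsim B B' -> hsim (dirsum A B) (dirsum A' B').
Proof.
case=> P [Q [PQ QP APA]] [P' [Q' [PQ' QP' BPB]]].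
exists (block_mx P 0 0 P'), (block_mx Q 0 0 Q'); rewrite /dirsum !mulmx_block.
rewrite !mul0mx !mulmx0 !addr0 !add0r PQ QP PQ' QP' APA BPB.
by rewrite -!scalar_mx_block.
Qed.

(** Reindexing rows and columns by the same bijection is conjugation by a permutation matrix, here
    cut out of the identity. *)
Lemma hsim_mxsub m n (f : 'I_m -> 'I_n) (g : 'I_n -> 'I_m) (B : 'M_n) :
  cancel f g -> cancel g f -> hsim (mxsub f f B) B.
Proof.
move=> fK gK; pose P : 'M[F]_(m, n) := rowsub f 1%:M.
pose Q : 'M[F]_(n, m) := colsub f 1%:M.
have QP : Q *m P = 1%:M.
  apply/matrixP=> i j; rewrite !mxE (bigD1 (g i)) //= big1 => [|k ki].
    by rewrite !mxE gK eqxx mul1r addr0.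
  rewrite !mxE; case: eqP => [ik|_]; last by rewrite mul0r.
  by rewrite ik fK eqxx in ki.
have PBQ (C : 'M_n) : P *m C *m Q = mxsub f f C.
  by rewrite /P /Q mul_rowsub_mx mul1mx mulmx_colsub mulmx1;
    apply/matrixP=> i j; rewrite !mxE.
have PQ : P *m Q = 1%:M.
  rewrite -[P]mulmx1 PBQ; apply/matrixP=> i j; rewrite !mxE.
  by rewrite (can_eq fK).
by exists P, Q; split=> //; rewrite -PBQ -!mulmxA QP mulmx1.
Qed.

Lemma hsim_dirsumC m n (A : 'M_m) (B : 'M_n) : hsim (dirsum A B) (dirsum B A).
Proof.
exists (block_mx 0 1%:M 1%:M 0), (block_mx 0 1%:M 1%:M 0).
by rewrite /dirsum !mulmx_block !(mul0mx, mulmx0, mulmx1, mul1mx, addr0, add0r)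
  -!scalar_mx_block.
Qed.

Lemma hsim_dirsum0r m (A : 'M_m) (B : 'M_0) : hsim (dirsum A B) A.
Proof.
exists (col_mx 1%:M 0), (row_mx 1%:M 0).
rewrite /dirsum mul_col_row mul_row_col mul_block_col mul_col_mx.
rewrite !(mul0mx, mulmx0, mulmx1, mul1mx, addr0, add0r); split=> //.
by rewrite [RHS](scalar_mx_block _ _ 1); congr block_mx;
  apply/matrixP=> [[] ? ?] [].
Qed.

Lemma hsim_dirsum0l m (A : 'M_m) (B : 'M_0) : hsim (dirsum B A) A.
Proof. exact: hsim_trans (hsim_dirsumC _ _) (hsim_dirsum0r _ _). Qed.

Lemma hsim_dirsumA m n p (A : 'M_m) (B : 'M_n) (C : 'M_p) :
  hsim (dirsum A (dirsum B C)) (dirsum (dirsum A B) C).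
Proof.
have /= := @block_mxA _ _ _ _ _ _ _ A 0 0 0 B 0 0 0 C.
rewrite !row_mx0 !col_mx0 /dirsum => ->; exact: hsim_castmx.
Qed.

Lemma hsim_empty m n (A : 'M[F]_m) (B : 'M[F]_n) : m = 0 -> n = 0 -> hsim A B.
Proof.
by move=> m0 n0; subst m n; apply/eq_hsim/matrixP=> -[].
Qed.

(** The size of a block diagonal matrix is a sum that has to be cast when a block is split off;
    [hsim] absorbs the cast and so permits induction on the number of blocks. *)
Lemma hsim_mxdiag_recl r (p : 'I_r.+1 -> nat) (B : forall i, 'M[F]_(p i)) :
  hsim (mxdiag B) (dirsum (B ord0) (\mxdiag_i B (lift ord0 i))).
Proof.
have -> := mxdiag_recl B; exact: hsim_castmx.
Qed.

Lemma hsim_mxdiag r (p q : 'I_r -> nat)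
    (A : forall i, 'M[F]_(p i)) (B : forall i, 'M[F]_(q i)) :
  (forall i, hsim (A i) (B i)) -> hsim (mxdiag A) (mxdiag B).
Proof.
elim: r p q A B => [|r IHr] p q A B AB.
  by apply: hsim_empty; rewrite big_ord0.
apply: hsim_trans (hsim_mxdiag_recl A) _.
apply: hsim_trans _ (hsim_sym (hsim_mxdiag_recl B)).
by apply: hsim_dirsum; last exact: IHr.
Qed.

End Similarity.

(** * Jordan matrices, characteristic polynomials and spectra *)

Section Jordan.
Variable F : fieldType.
Implicit Types (L : seq (nat * F)) (z : F).

Lemma hsim_jordan_cons (b : nat * F) L :
  hsim (jordan_mx (b :: L)) (dirsum (jordan_block b.1 b.2) (jordan_mx L)).
Proof.
apply: hsim_trans (hsim_mxdiag_recl _) _.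
apply: hsim_dirsum; first exact: hsim_refl.
apply: hsim_mxdiag => i.
suff -> : tnth (in_tuple (b :: L)) (lift ord0 i) = tnth (in_tuple L) i.
  exact: hsim_refl.
by rewrite !(tnth_nth b).
Qed.

Lemma hsim_jordan_nil (A : 'M_0) : hsim (jordan_mx ([::] : seq (nat * F))) A.
Proof.
by apply: hsim_empty; rewrite ?big_ord0.
Qed.

Lemma hsim_jordan_cat L1 L2 :
  hsim (jordan_mx (L1 ++ L2)) (dirsum (jordan_mx L1) (jordan_mx L2)).
Proof.
elim: L1 => [|b L1 IH] /=.
  apply: hsim_sym.
  apply: hsim_trans (hsim_dirsum (hsim_jordan_nil 0) (hsim_refl _)) _.
  exact: hsim_dirsum0l.
apply: hsim_trans (hsim_jordan_cons _ _) _.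
apply: hsim_trans (hsim_dirsum (hsim_refl _) IH) _.
apply: hsim_trans (hsim_dirsumA _ _ _) _.
by apply: hsim_dirsum (hsim_sym (hsim_jordan_cons _ _)) (hsim_refl _).
Qed.

(** Permutations are generated by exchanges of two adjacent segments at the head of a list, so
    commutativity of the direct sum suffices. *)
Lemma hsim_jordan_perm L1 L2 :
  perm_eq L1 L2 -> hsim (jordan_mx L1) (jordan_mx L2).
Proof.
move=> p12; pose P s := hsim (jordan_mx L1) (jordan_mx s).
apply: (@catCA_perm_ind _ P _ _ _ p12 (hsim_refl _)) => s1 s2 s3 H.
apply: hsim_trans H _; rewrite !catA.
apply: hsim_trans (hsim_jordan_cat _ _) _.
apply: hsim_trans _ (hsim_sym (hsim_jordan_cat _ _)).
apply: hsim_dirsum (hsim_refl _).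
apply: hsim_trans (hsim_jordan_cat _ _) _.
apply: hsim_trans _ (hsim_sym (hsim_jordan_cat _ _)).
exact: hsim_dirsumC.
Qed.

Lemma hsim_mxdiag_jordan r (p : 'I_r -> nat) (B : forall i, 'M[F]_(p i))
    (f : 'I_r -> seq (nat * F)) :
  (forall i, hsim (B i) (jordan_mx (f i))) ->
  hsim (mxdiag B) (jordan_mx (flatten [seq f i | i <- enum 'I_r])).
Proof.
elim: r p B f => [|r IHr] p B f Bf.
  rewrite enum_ord0 /=.
  by apply: hsim_empty; rewrite big_ord0.
rewrite enum_ordSl /= -map_comp.
apply: hsim_trans (hsim_mxdiag_recl B) _.
apply: hsim_trans _ (hsim_sym (hsim_jordan_cat _ _)).
by apply: hsim_dirsum; last exact: IHr.
Qed.

Lemma hsim_jordan1 (b : nat * F) :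
  hsim (jordan_mx [:: b]) (jordan_block b.1 b.2).
Proof.
apply: hsim_trans (hsim_jordan_cons _ _) _.
apply: hsim_trans (hsim_dirsum (hsim_refl _) (hsim_jordan_nil 0)) _.
exact: hsim_dirsum0r.
Qed.

Lemma jordan_block1 z : jordan_block 1 z = z%:M.
Proof. by apply/matrixP=> i j; rewrite !ord1 !mxE. Qed.

Lemma jordan_block2 : jordan_block 2 (0 : F) = delta_mx 0 1.
Proof.
by apply/matrixP=> [[[|[|[]]] //= ?] [[|[|[]]] //= ?]]; rewrite !mxE.
Qed.

Lemma size_jordan L :
  (\sum_(i < size L) (tnth (in_tuple L) i).1 = sumn [seq b.1 | b <- L])%N.
Proof. by rewrite sumnE big_map big_tnth. Qed.

End Jordan.

Section CharPoly.
Variable F : fieldType.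

Lemma char_poly_hsim m n (A : 'M[F]_m) (B : 'M_n) :
  hsim A B -> char_poly A = char_poly B.
Proof.
move=> AB; have emn := hsim_size AB.
case: n / emn B AB => B [P [Q [PQ QP APB]]].
have eA : A = P *m B *m Q by rewrite -APB -mulmxA PQ mulmx1.
pose f := map_mx (@polyC F) : 'M_m -> 'M_m.
have fPQ : f P *m f Q = 1%:M by rewrite -map_mxM PQ map_mx1.
have -> : char_poly A = \det (f P *m char_poly_mx B *m f Q).
  rewrite /char_poly /char_poly_mx eA; congr (\det _).
  rewrite mulmxBr mulmxBl !map_mxM; congr (_ - _).
  by rewrite scalar_mxC -mulmxA fPQ mulmx1.
by rewrite !det_mulmx mulrAC -det_mulmx fPQ det1 mul1r.
Qed.

Lemma char_poly_dirsum m n (A : 'M[F]_m) (B : 'M_n) :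
  char_poly (dirsum A B) = char_poly A * char_poly B.
Proof. by rewrite /char_poly char_block_diag_mx det_ublock. Qed.

Lemma char_poly_mxdiag r (p : 'I_r -> nat) (B : forall i, 'M[F]_(p i)) :
  char_poly (mxdiag B) = \prod_i char_poly (B i).
Proof.
elim: r p B => [|r IHr] p B.
  rewrite [RHS]big_ord0 -[RHS](det_mx00 (char_poly_mx (0 : 'M[F]_0))).
  by apply: char_poly_hsim; apply: hsim_empty; rewrite ?big_ord0.
rewrite [RHS]big_ord_recl (char_poly_hsim (hsim_mxdiag_recl B)).
by rewrite char_poly_dirsum IHr.
Qed.

Lemma char_poly_jordan_block k (z : F) :
  char_poly (jordan_block k z) = ('X - z%:P) ^+ k.
Proof.
(* Jordan blocks are upper triangular, whereas [char_poly_trig] is about lower triangular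
   matrices. *)
rewrite /char_poly -det_tr.
have -> : (char_poly_mx (jordan_block k z))^T =
    char_poly_mx (jordan_block k z)^T.
  by rewrite /char_poly_mx linearB /= tr_scalar_mx map_trmx.
rewrite -/(char_poly _) char_poly_trig; last first.
  apply/is_trig_mxP => i j ij; rewrite !mxE; case: eqP => [e|_].
    by rewrite e ltnn in ij.
  by case: eqP ij => // e; rewrite ltnNge [(j <= i)%N]ltnW ?e.
rewrite (eq_bigr (fun=> 'X - z%:P)) ?prodr_const ?card_ord // => i _.
by rewrite !mxE eqxx.
Qed.

Lemma char_poly_jordan (L : seq (nat * F)) :
  char_poly (jordan_mx L) =
    \prod_(z <- flatten [seq nseq b.1 b.2 | b <- L]) ('X - z%:P).
Proof.
rewrite char_poly_mxdiag [RHS]big_flatten [RHS]big_map [RHS]big_tnth /=.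
apply: eq_bigr => i _.
by rewrite char_poly_jordan_block big_nseq -Monoid.iteropE.
Qed.

Lemma char_poly_traceless (B : 'M[F]_2) :
  \tr B = 0 -> char_poly B = 'X^2 + (\det B)%:P.
Proof.
move=> trB; have /monicP := char_poly_monic B.
have := char_poly_det B; have /= := char_poly_trace B isT; rewrite /lead_coef.
have := size_char_poly B => sB; rewrite sB /= => c1 c0 c2.
apply/polyP=> -[|[|[|i]]]; rewrite coefD coefXn coefC /= ?c1 ?c0 ?c2.
- by rewrite sqrrN expr1n mul1r add0r.
- by rewrite trB oppr0 addr0.
- by rewrite addr0.
- by rewrite addr0 nth_default ?sB.
Qed.

End CharPoly.

Section Spectrum.
Variable F : closedFieldType.

(** An equality of sequences, not merely of multisets, since [spectrum] is computed from the
    characteristic polynomial alone. *)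
Lemma spectrum_hsim m n (A : 'M[F]_m) (B : 'M_n) :
  hsim A B -> spectrum A = spectrum B.
Proof. by move=> /char_poly_hsim e; rewrite /spectrum e. Qed.

Lemma perm_spectrum n (A : 'M[F]_n) s :
  char_poly A = \prod_(z <- s) ('X - z%:P) -> perm_eq (spectrum A) s.
Proof. by move=> e; apply: prod_XsubC_eq; rewrite -spectrumE. Qed.

Lemma size_spectrum n (A : 'M[F]_n) : size (spectrum A) = n.
Proof.
by apply: succn_inj; rewrite -(size_prod_XsubC _ id) -spectrumE size_char_poly.
Qed.

Lemma spectrum_dirsum m n (A : 'M[F]_m) (B : 'M_n) :
  perm_eq (spectrum (dirsum A B)) (spectrum A ++ spectrum B).
Proof.
by apply: perm_spectrum; rewrite char_poly_dirsum !spectrumE big_cat.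
Qed.

Lemma spectrum_jordan (L : seq (nat * F)) :
  perm_eq (spectrum (jordan_mx L)) (flatten [seq nseq b.1 b.2 | b <- L]).
Proof. exact/perm_spectrum/char_poly_jordan. Qed.

End Spectrum.

(** * Symmetric and c-symmetric multisets *)

Section SymmetricSpectra.
Variable F : fieldType.
Implicit Types (s t lam : seq F) (c z : F).

(** Turns symmetry into an identity between multiplicities, which add up under concatenation and can
    then be cancelled. *)
Lemma symmetric_spectrumP s :
  symmetric_spectrum s <-> forall z, count_mem (- z) s = count_mem z s.
Proof.
have count_opp z : count_mem z [seq - y | y <- s] = count_mem (- z) s.
  by rewrite count_map; apply: eq_count => y /=; rewrite eqr_oppLR.
split=> [/permP ss z|ss]; first by rewrite -count_opp ss.
by apply/allP=> z _; rewrite /= count_opp ss.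
Qed.

Lemma symmetric_spectrum_perm s t :
  perm_eq s t -> symmetric_spectrum s -> symmetric_spectrum t.
Proof.
move=> /permP st /symmetric_spectrumP ss.
by apply/symmetric_spectrumP => z; rewrite -!st.
Qed.

Lemma symmetric_spectrum_cat s t :
  symmetric_spectrum s -> symmetric_spectrum (s ++ t) <-> symmetric_spectrum t.
Proof.
move=> /symmetric_spectrumP ss; split=> /symmetric_spectrumP st;
  apply/symmetric_spectrumP => z.
  by have := st z; rewrite !count_cat ss => /addnI.
by rewrite !count_cat ss st.
Qed.

Lemma symmetric_spectrum0 k : symmetric_spectrum (nseq k (0 : F)).
Proof. by rewrite /symmetric_spectrum map_nseq oppr0. Qed.

Lemma symmetric_spectrum_opp lam :
  symmetric_spectrum (lam ++ [seq - z | z <- lam]).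
Proof.
rewrite /symmetric_spectrum map_cat perm_catC perm_cat2r -map_comp.
by rewrite -[X in perm_eq _ X]map_id (eq_map (@opprK _ : _ =1 id)).
Qed.

Lemma c_symmetric_spectrum_perm s t :
  perm_eq s t -> c_symmetric_spectrum s -> c_symmetric_spectrum t.
Proof.
move=> st [odds [c cs ss]]; split; first by rewrite -(perm_size st).
exists c; first by rewrite -(perm_mem st).
apply: symmetric_spectrum_perm ss.
have ct : c \in t by rewrite -(perm_mem st).
rewrite -(perm_cons c); apply: perm_trans (perm_trans st (perm_to_rem ct)).
by rewrite perm_sym perm_to_rem.
Qed.

Lemma c_symmetric_spectrum_cat s t : ~~ odd (size s) ->
  symmetric_spectrum s -> c_symmetric_spectrum t ->
    c_symmetric_spectrum (s ++ t).
Proof.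
move=> evens syms [oddt [c ct symt]].
apply: (@c_symmetric_spectrum_perm (c :: s ++ rem c t)).
  rewrite perm_sym; apply: perm_trans (_ : perm_eq (s ++ c :: rem c t) _).
    by rewrite perm_cat2l perm_to_rem.
  by rewrite -cat1s perm_catCA.
split; last first.
  by exists c; rewrite ?mem_head //= eqxx;
    apply/(symmetric_spectrum_cat _ syms).
by move: oddt; rewrite (perm_size (perm_to_rem ct)) /= size_cat oddD
  (negPf evens).
Qed.

Lemma c_symmetric_spectrum_opp c lam :
  c_symmetric_spectrum (c :: lam ++ [seq - z | z <- lam]).
Proof.
split; first by rewrite /= size_cat size_map addnn odd_double.
by exists c; rewrite ?mem_head //= eqxx; apply: symmetric_spectrum_opp.
Qed.

End SymmetricSpectra.

(** * Matching the elements of symmetric multisets in opposite pairs *)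

Section Pairing.
Variable F : numFieldType.
Implicit Types (s t lam : seq F) (c z : F).

(** A nonzero [z] in [s] comes with [- z], which differs from [z] in characteristic 0; both are
    removed and induction on the size applies. Once only zeros remain, they are paired with each
    other, and one is left over in odd size. *)
Lemma symmetric_spectrum_pairing s : symmetric_spectrum s ->
  exists lam, perm_eq s (nseq (odd (size s)) 0 ++ lam ++ [seq - z | z <- lam]).
Proof.
have [k] := ubnP (size s); elim: k s => // k IHk s lt_s ss.
have [/allP s0|/allPn[z zs z0]] := boolP (all (pred1 0) s).
  exists (nseq (size s)./2 0); rewrite map_nseq oppr0.
  rewrite -nseqD -nseqD addnn odd_double_half.
  by have /all_pred1P {1}-> : all (pred1 0) s by apply/allP.
have zNz : (- z == z) = false by rewrite eqNr; apply: negPf.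
have Nzs : - z \in rem z s.
  have /symmetric_spectrumP/(_ z) cz := ss.
  have /permP/(_ (pred1 (- z))) /= := perm_to_rem zs.
  rewrite cz [z == _]eq_sym zNz add0n -has_pred1 has_count => <-.
  by rewrite -has_count has_pred1.
have st : perm_eq s [:: z, - z & rem (- z) (rem z s)].
  by apply: perm_trans (perm_to_rem zs) _; rewrite perm_cons perm_to_rem.
set t := rem (- z) (rem z s) in st.
have sz := perm_size st; rewrite /= in sz.
have [||lam tlam] := IHk t; first by rewrite sz in lt_s; lia.
  apply/(symmetric_spectrum_cat t (symmetric_spectrum_opp [:: z])).
  exact: symmetric_spectrum_perm st ss.
exists (z :: lam); apply: perm_trans st _; rewrite sz /= negbK.
apply/permP=> p; have /permP/(_ p) := tlam.
rewrite /= !count_cat /= count_cat /=; lia.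
Qed.

Lemma c_symmetric_spectrum_pairing s : c_symmetric_spectrum s ->
  exists c lam, perm_eq s (c :: lam ++ [seq - z | z <- lam]).
Proof.
case=> odds [c cs /symmetric_spectrum_pairing[lam]].
have -> : odd (size (rem c s)) = false.
  by move: odds; rewrite (perm_size (perm_to_rem cs)) /= => /negPf.
move=> slam; exists c, lam; apply: perm_trans (perm_to_rem cs) _.
by rewrite perm_cons.
Qed.

Lemma c_symmetric_spectrum_cat0 k s : ~~ odd k ->
  c_symmetric_spectrum (nseq k 0 ++ s) -> c_symmetric_spectrum s.
Proof.
move=> evenk [odds [c cs /symmetric_spectrumP ss]].
have cnt z : (count_mem z (nseq k 0%R) + count_mem z s =
    (c == z) + count_mem z (rem c (nseq k 0%R ++ s)))%N.
  by rewrite -count_cat; have /permP/(_ (pred1 z)) := perm_to_rem cs.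
have {}odds : odd (size s).
  by move: odds; rewrite size_cat size_nseq oddD (negPf evenk).
have cnt0 z : count_mem (- z) (nseq k (0 : F)) = count_mem z (nseq k (0 : F)).
  by rewrite !count_nseq /= eq_sym oppr_eq0 [z == 0]eq_sym.
(* If the center [c] lies in [s], it serves for [s] as well. Otherwise [c = 0] and [s] is itself
   symmetric; having odd size, it contains 0 by the pairing, a contradiction. *)
have [cs'|cNs] := boolP (c \in s).
  split=> //; exists c => //; apply/symmetric_spectrumP=> z.
  have cnt' y : count_mem y s = ((c == y) + count_mem y (rem c s))%N.
    by have /permP/(_ (pred1 y)) := perm_to_rem cs'.
  have := cnt z; have := cnt (- z); rewrite cnt0 ss !cnt'.
  by rewrite !(addnCA _ (c == _ : bool)) => /addnI <- /addnI /addnI.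
have c0 : c = 0.
  by move: cs; rewrite mem_cat (negPf cNs) orbF mem_nseq => /andP[_ /eqP].
have sym_s : symmetric_spectrum s.
  apply/symmetric_spectrumP=> z.
  by have := cnt z; have := cnt (- z);
    rewrite cnt0 ss c0 [0 == - z]eq_sym oppr_eq0 [0 == z]eq_sym => <- /addnI ->.
have [lam slam] := symmetric_spectrum_pairing sym_s.
by move: cNs; rewrite c0 (perm_mem slam) odds mem_cat mem_head.
Qed.

End Pairing.

(** * Splitting off Jordan blocks of size two *)

Section Splitting.
Variable F : fieldType.

(* [V *m invmx (U *m V) *m U] projects onto the row space of [U] along the left
   kernel of [V], and both are stable under [M]. *)
Lemma hsim_split k n (M : 'M[F]_n)
    (U : 'M_(k, n)) (V : 'M_(n, k)) (J J' : 'M_k) :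
    U *m M = J *m U -> M *m V = V *m J' -> U *m V \in unitmx ->
  exists t (M' : 'M_t) (T : 'M_(t, n)) (C : 'M_(n, t)),
    [/\ hsim M (dirsum J M'), T *m C = 1%:M & T *m M = M' *m T].
Proof.
move=> UM MV UVu; pose W := invmx (U *m V); pose X := 1%:M - V *m W *m U.
(* A full-rank factorization of the complementary projection [X]: the rows of [T] form a basis of
   the left kernel of [V], on which [M] acts as [T *m M *m C]. *)
pose T := row_base X; pose C := col_base X.
have CT : C *m T = X := mulmx_base X.
have XV : X *m V = 0 by rewrite mulmxBl mul1mx -!mulmxA mulVmx // mulmx1 subrr.
have UX : U *m X = 0 by rewrite mulmxBr mulmx1 !mulmxA mulmxV // mul1mx subrr.
have Cinj m (Y Z : 'M_(_, m)) : C *m Y = C *m Z -> Y = Z.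
  exact: row_full_inj (col_base_full X) _ _.
have Tinj m (Y Z : 'M_(m, _)) : Y *m T = Z *m T -> Y = Z.
  exact: row_free_inj (row_base_free X) _ _.
have TV : T *m V = 0 by apply: Cinj; rewrite mulmxA CT XV mulmx0.
have UC : U *m C = 0 by apply: Tinj; rewrite -mulmxA CT UX mul0mx.
have TX : T *m X = T by rewrite mulmxBr mulmx1 !mulmxA TV !mul0mx subr0.
have TC : T *m C = 1%:M by apply: Tinj; rewrite -mulmxA CT TX mul1mx.
have TM : T *m M = T *m M *m C *m T.
  rewrite -(mulmxA _ C) CT mulmxBr mulmx1 !mulmxA -(mulmxA T M) MV.
  by rewrite !mulmxA TV !mul0mx subr0.
exists (\rank X), (T *m M *m C), T, C; split=> //; apply: hsim_sym.
exists (col_mx U T), (row_mx (V *m W) C); split.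
- rewrite mul_col_row (mulmxA U) (mulmxA T) mulmxV // UC TV mul0mx TC.
  by rewrite -scalar_mx_block.
- by rewrite mul_row_col CT addrC subrK.
- by rewrite mul_block_col mul_col_mx !mul0mx addr0 add0r UM -TM.
Qed.

(* The value at [A] of the polynomial with roots [rs]; unlike [horner_mx], it
   makes sense for matrices of size 0. *)
Fixpoint eval_roots (rs : seq F) n (A : 'M_n) : 'M_n :=
  if rs is z :: rs' then (A - z%:M) *m eval_roots rs' A else 1%:M.

(** A rectangular [T] carries annihilating polynomials over to direct summands; [T = A = B] shows
    that a polynomial in a matrix commutes with it. *)
Lemma eval_roots_intertwine rs m n (T : 'M[F]_(m, n)) (A : 'M_n) (B : 'M_m) :
  T *m A = B *m T -> T *m eval_roots rs A = eval_roots rs B *m T.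
Proof.
move=> TA; elim: rs => [|z rs IH] /=; first by rewrite mulmx1 mul1mx.
rewrite mulmxA mulmxBr TA scalar_mxC -mulmxBl.
by rewrite -!mulmxA IH.
Qed.

Lemma eval_roots_eigen rs m n (A : 'M[F]_n) (X : 'M_(n, m)) c :
  A *m X = c *: X -> eval_roots rs A *m X = (\prod_(z <- rs) (c - z)) *: X.
Proof.
move=> AX; elim: rs => [|z rs IH] /=; first by rewrite big_nil mul1mx scale1r.
by rewrite big_cons -mulmxA IH -scalemxAr mulmxBl AX mul_scalar_mx -scalerBl
  scalerA mulrC.
Qed.

Lemma eval_rootsE rs n (A : 'M[F]_n.+1) :
  eval_roots rs A = horner_mx A (\prod_(z <- rs) ('X - z%:P)).
Proof.
elim: rs => [|z rs IH] /=; first by rewrite big_nil [RHS]rmorph1.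
by rewrite big_cons rmorphM rmorphB /= horner_mx_X horner_mx_C IH.
Qed.

(** The minimal polynomial divides a product of distinct linear factors. Size 0 is treated apart, as
    [horner_mx] requires a positive size. *)
Lemma diagonalizable_eval_roots rs n (A : 'M[F]_n) :
  uniq rs -> eval_roots rs A = 0 -> diagonalizable A.
Proof.
case: n A => [|n] A uniq_rs rsA.
  by rewrite [A]thinmx0; apply: diagonalizable0.
by apply/diagonalizableP; exists rs => //; apply: mxminpoly_min;
  rewrite -eval_rootsE.
Qed.

Lemma hsim_diag n (d : 'rV[F]_n) :
  hsim (diag_mx d) (jordan_mx [seq (1%N, d 0 i) | i <- enum 'I_n]).
Proof.
elim: n d => [|n IHn] d.
  by rewrite enum_ord0; apply/hsim_sym/hsim_jordan_nil.
rewrite enum_ordSl /= -map_comp.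
apply: hsim_trans _ (hsim_sym (hsim_jordan_cons _ _)).
have -> : diag_mx d =
    dirsum (diag_mx (@lsubmx _ 1 1 n d)) (diag_mx (@rsubmx _ 1 1 n d)).
  by rewrite /dirsum -diag_mx_row hsubmxK.
apply: (@hsim_dirsum _ 1 n).
  by rewrite jordan_block1; apply: eq_hsim; apply/matrixP=> i j;
    rewrite !ord1 !mxE lshift0.
apply: hsim_trans (IHn _) _.
rewrite (@eq_map _ _ _ ((fun i => (1%N, d 0 i)) \o lift ord0));
  first exact: hsim_refl.
by move=> i /=; rewrite mxE rshift1.
Qed.

Lemma hsim_diagonalizable n (A : 'M[F]_n) :
  diagonalizable A ->
  exists ds : seq F, hsim A (jordan_mx [seq (1%N, z) | z <- ds]).
Proof.
case=> P Pu /diagonalizable_forPex[d /(simmxP Pu) PA].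
exists [seq d 0 i | i <- enum 'I_n]; rewrite -map_comp.
apply: hsim_trans _ (hsim_diag d).
exists (invmx P), P; rewrite mulmxV ?mulVmx //; split=> //.
by rewrite -[LHS](mulKmx Pu) (mulmxA P) PA mulmxK.
Qed.

(* With q the polynomial with roots [rs], if M q(M) != 0 then some row u and
   column v of q(M) satisfy u M v != 0, although u M^2 = 0 and M^2 v = 0. Thus
   [hsim_split] applies to (u, u M) and (M v, v), and splits off one block. *)
Lemma hsim_peel (rs : seq F) n (M : 'M[F]_n) : 0 \notin rs ->
    M *m M *m eval_roots rs M = 0 ->
  exists s t (D : 'M_t),
    hsim M (dirsum (jordan_mx (nseq s (2%N, 0))) D) /\
      eval_roots (0 :: rs) D = 0.
Proof.
move=> rs0; have [k] := ubnP n; elim: k n M => // k IHk n M lt_n MMq.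
set q := eval_roots rs in MMq *.
have qM : q n M *m M = M *m q n M by apply/esym/eval_roots_intertwine.
have [Mq0|/matrix0Pn[i [j Mq_ij]]] := eqVneq (M *m q n M) 0.
  exists 0%N, n, M; split; last by rewrite /= raddf0 subr0.
  apply: hsim_sym; apply: hsim_trans (hsim_dirsum0l _ (0 : 'M_0)).
  exact: hsim_dirsum (hsim_jordan_nil 0) (hsim_refl _).
(* The columns of [M *m q n M] are killed by [M], so q(M) acts on them as the scalar q(0). *)
have qMq : q n M *m (M *m q n M) = (\prod_(z <- rs) (0 - z)) *: (M *m q n M).
  by apply: eval_roots_eigen; rewrite mulmxA MMq scale0r.
pose u := row i (q n M); pose v := col j (q n M).
pose U : 'M_(1 + 1, n) := col_mx u (u *m M).
pose V : 'M_(n, 1 + 1) := row_mx (M *m v) v.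
pose J : 'M[F]_(1 + 1) := block_mx 0 1%:M 0 0.
have uMM : u *m M *m M = 0 by rewrite -!row_mul qM -mulmxA qM mulmxA MMq row0.
have MMv : M *m (M *m v) = 0 by rewrite /v colE !mulmxA MMq mul0mx.
have UM : U *m M = J *m U.
  by rewrite mul_col_mx uMM mul_block_col !mul0mx mul1mx add0r addr0.
have MV : M *m V = V *m J.
  by rewrite mul_mx_row MMv mul_row_block !mulmx0 mulmx1 !addr0.
(* This 1x1 matrix holds the entry at [(i, j)] of q(M) M q(M) = q(0) M q(M), and q(0) is nonzero
   because 0 is not in [rs]. *)
have uMv : \det (u *m (M *m v)) != 0.
  rewrite det_mx11 /u /v !colE rowE -!mulmxA (mulmxA M).
  rewrite (mulmxA _ _ (delta_mx _ _)) qMq.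
  rewrite -scalemxAl -scalemxAr -colE -rowE mxE mulf_neq0 //;
    last by rewrite 2!mxE.
  rewrite prodf_seq_neq0; apply/allP=> z zrs /=; rewrite sub0r oppr_eq0.
  by apply: contraNneq rs0 => <-.
have UVu : U *m V \in unitmx.
  have -> : U *m V = block_mx (u *m (M *m v)) (u *m v) 0 (u *m (M *m v)).
    by rewrite mul_col_row -!(mulmxA u) MMv mulmx0.
  by rewrite unitmxE det_ublock unitfE mulf_neq0.
have [t [M' [T [C [MM' TC TM]]]]] := hsim_split UM MV UVu.
(* The annihilating polynomial passes from [M] to [M'] through [T], which is then cancelled by its
   right inverse [C]. *)
have MMq' : M' *m M' *m q t M' = 0.
  suff MT : M' *m M' *m q t M' *m T = 0.
    by rewrite -[LHS]mulmx1 -TC mulmxA MT mul0mx.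
  rewrite -mulmxA -(eval_roots_intertwine rs TM) mulmxA -(mulmxA M') -TM.
  by rewrite (mulmxA M') -TM -(mulmxA T) -(mulmxA T) MMq mulmx0.
have en := hsim_size MM'.
have [|s [t' [D [M'D D0]]]] := IHk t M' _ MMq'; first by lia.
exists s.+1, t', D; split=> //.
apply: hsim_trans MM' _; apply: hsim_trans (hsim_dirsum (hsim_refl _) M'D) _.
apply: hsim_trans (hsim_dirsumA _ _ _) _; apply: hsim_dirsum (hsim_refl _).
apply: hsim_sym; apply: hsim_trans (hsim_jordan_cons _ _) _;
  rewrite /= jordan_block2.
apply: hsim_dirsum (hsim_refl _); apply: eq_hsim.
apply/matrixP=> a b; rewrite -(@splitK 1 1 a) -(@splitK 1 1 b).
by case: (@split 1 1 a) (@split 1 1 b) => [a'|a'] [b'|b'];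
  rewrite /J /unsplit ?(@block_mxEul _ 1 1 1 1, @block_mxEur _ 1 1 1 1,
    @block_mxEdl _ 1 1 1 1, @block_mxEdr _ 1 1 1 1) !ord1 !mxE.
Qed.

End Splitting.

(** * Generalized eigenvectors *)

Section GenEigen.
Variable F : fieldType.

(* Equivalent to the condition on generalized eigenvectors in (c), but visibly
   inherited by direct sums. *)
Definition semisimple_off0 n (A : 'M[F]_n) : Prop :=
  forall z r (x : 'cV_n), (A - z%:M) ^+ r *m x = 0 ->
    A *m ((A - z%:M) *m x) = 0.

Lemma eval_roots_nseq r z n (A : 'M[F]_n) :
  eval_roots (nseq r z) A = (A - z%:M) ^+ r.
Proof. by elim: r => [|r IHr] //=; rewrite IHr exprS. Qed.

(** [T] maps the kernel of [(A - z%:M) ^+ r] into that of [(B - z%:M) ^+ r]. This covers both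
    changes of basis and the coordinate projections of a direct sum. *)
Lemma semisimple_off0_intertwine m n (T : 'M[F]_(m, n)) A B z r (x : 'cV_n) :
    T *m A = B *m T -> semisimple_off0 B -> (A - z%:M) ^+ r *m x = 0 ->
  T *m (A *m ((A - z%:M) *m x)) = 0.
Proof.
move=> TA ssB Ax; have TAz : T *m (A - z%:M) = (B - z%:M) *m T.
  by rewrite mulmxBr mulmxBl TA scalar_mxC.
rewrite mulmxA TA -mulmxA (mulmxA T) TAz -(mulmxA _ T); apply: (ssB z r).
by rewrite -eval_roots_nseq mulmxA -(eval_roots_intertwine _ TA) eval_roots_nseq
  -mulmxA Ax mulmx0.
Qed.

Lemma semisimple_off0_hsim m n (A : 'M[F]_m) (B : 'M_n) :
  hsim A B -> semisimple_off0 B -> semisimple_off0 A.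
Proof.
move=> /hsim_sym[Q [P [QP PQ BQ]]] ssB z r x Ax.
have := semisimple_off0_intertwine (esym BQ) ssB Ax.
by move=> /(congr1 (mulmx P)); rewrite mulmxA PQ mul1mx mulmx0.
Qed.

Lemma semisimple_off0_dirsum m n (A : 'M[F]_m) (B : 'M_n) :
  semisimple_off0 A -> semisimple_off0 B -> semisimple_off0 (dirsum A B).
Proof.
move=> ssA ssB z r x ABx.
have TA : row_mx 1%:M 0 *m dirsum A B = A *m row_mx 1%:M 0.
  by rewrite mul_row_block mul_mx_row !(mulmx0, mul0mx, mulmx1, mul1mx, addr0).
have TB : row_mx 0 1%:M *m dirsum A B = B *m row_mx 0 1%:M.
  by rewrite mul_row_block mul_mx_row !(mulmx0, mul0mx, mulmx1, mul1mx, add0r).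
rewrite -[LHS]mul1mx [1%:M]scalar_mx_block block_mxEv mul_col_mx.
rewrite (semisimple_off0_intertwine TA ssA ABx).
by rewrite (semisimple_off0_intertwine TB ssB ABx) col_mx0.
Qed.

Lemma semisimple_off0_mxdiag r (p : 'I_r -> nat) (B : forall i, 'M[F]_(p i)) :
  (forall i, semisimple_off0 (B i)) -> semisimple_off0 (mxdiag B).
Proof.
elim: r p B => [|r IHr] p B ssB.
  by move=> z k x _; move: (mxdiag B) x; rewrite big_ord0 => ? x;
    rewrite [x]flatmx0 !mulmx0.
apply: semisimple_off0_hsim (hsim_mxdiag_recl B) _.
by apply: semisimple_off0_dirsum; last exact: IHr.
Qed.

Lemma semisimple_off0_scalar n (a : F) : semisimple_off0 (a%:M : 'M_n).
Proof.
move=> z r x; rewrite -raddfB /=.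
have -> : (a - z)%:M ^+ r = ((a - z) ^+ r)%:M :> 'M[F]_n.
  by elim: r => [|r IHr] //; rewrite !exprS IHr [RHS]scalar_mxM.
rewrite !mul_scalar_mx => /eqP; rewrite scalemx_eq0 => /orP[|/eqP->].
  by rewrite expf_eq0 => /andP[_ /eqP->]; rewrite scale0r scaler0.
by rewrite !scaler0.
Qed.

(** For rank at least 2, let y be the last nonzero vector [(A - z%:M) ^+ r.-1 *m x]. Then [A] kills
    y, and so does [A - z%:M], hence [z *: y = 0] and [z = 0]. For [z = 0], rank at least 3 is
    excluded since y would be the image under [A] of a vector that [A] kills, written so that y
    vanishes. *)
Lemma gen_eigenvector_semisimple_off0 n (A : 'M[F]_n) z r (x : 'cV_n) :
  semisimple_off0 A -> gen_eigenvector A z r x -> r <> 1%N -> r = 2%N /\ z = 0.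
Proof.
move=> ssA []; case: r => [|[|r]] //= _ Ax Ax' _.
have comA : A *m (A - z%:M) = (A - z%:M) *m A.
  by rewrite mulmxBr mulmxBl scalar_mxC.
have Akx k : A *m ((A - z%:M) ^+ k.+1 *m x) = 0.
  elim: k => [|k IHk]; first by rewrite expr1; apply: ssA Ax.
  by rewrite exprS -[X in _ *m X]mulmxA mulmxA comA -mulmxA IHk mulmx0.
have [z0|z0] := eqVneq z 0.
  subst z; split=> //; case: r => // r in Ax Ax' *.
  by case/eqP: Ax'; rewrite exprS -[LHS]mulmxA {1}raddf0 {1}subr0 Akx.
have : z *: ((A - z%:M) ^+ r.+1 *m x) == 0.
  suff -> : z *: ((A - z%:M) ^+ r.+1 *m x) =
      A *m ((A - z%:M) ^+ r.+1 *m x) - (A - z%:M) ^+ r.+2 *m x.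
    by rewrite Akx Ax subr0.
  by rewrite (exprS _ r.+1) -[_ * _ *m x]mulmxA -mulmxBl subKr mul_scalar_mx.
by rewrite scalemx_eq0 (negPf z0) (negPf Ax').
Qed.

(** The least exponent that annihilates a nonzero column is its rank. Allowing several columns makes
    the result applicable to the identity or to a polynomial in [A]. *)
Lemma gen_eigenvector_le n (A : 'M[F]_n) z m :
    (forall r (x : 'cV_n), gen_eigenvector A z r x -> (r <= m)%N) ->
  forall p k (X : 'M_(n, p)), (A - z%:M) ^+ k *m X = 0 ->
    (A - z%:M) ^+ m *m X = 0.
Proof.
move=> Am p k X AX; apply/matrixP=> i j.
suff Am0 (x : 'cV_n) : (A - z%:M) ^+ k *m x = 0 -> (A - z%:M) ^+ m *m x = 0.
  have /Am0/colP/(_ i) : (A - z%:M) ^+ k *m (X *m delta_mx j (0 : 'I_1)) = 0.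
    by rewrite mulmxA AX mul0mx.
  by rewrite mulmxA -colE !mxE.
move=> Ax; have exk : exists k, (A - z%:M) ^+ k *m x == 0.
  by exists k; apply/eqP.
case: (ex_minnP exk) => r /eqP Arx minr.
have le_rm : (r <= m)%N.
  case: r => // r in Arx minr *; apply: (Am _ x); split=> //.
  by apply/negP => /minr /=; rewrite ltnn.
by rewrite -(subnK le_rm) exprD -[LHS]mulmxA Arx mulmx0.
Qed.

End GenEigen.

(** * Traceless matrices of size two *)

Section TracelessBlock.
Variable F : numFieldType.

Lemma sqr_traceless (B : 'M[F]_2) : \tr B = 0 -> B *m B = (- \det B)%:M.
Proof.
move=> /char_poly_traceless cB; have := Cayley_Hamilton B.
rewrite cB rmorphD rmorphXn /= horner_mx_X horner_mx_C => /eqP.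
by rewrite addr_eq0 => /eqP; rewrite raddfN => <-.
Qed.

(** With [d = - \det B], the product of [B + z%:M] and [B - z%:M] is the scalar [d - z ^+ 2]. If it
    is nonzero, [B - z%:M] is injective and [x = 0]. Otherwise the positive powers of [B - z%:M] are
    its multiples by powers of [- z *+ 2], so [B - z%:M] kills [x] when [z != 0], while [B *m B = 0]
    when [z = 0]. *)
Lemma semisimple_off0_traceless (B : 'M[F]_2) : \tr B = 0 -> semisimple_off0 B.
Proof.
move=> trB z r x Bx; have BB := sqr_traceless trB.
set d := - \det B in BB.
case: r => [|r] in Bx.
  by move: Bx; rewrite expr0 mul1mx => ->; rewrite !mulmx0.
have BzB : (B + z%:M) *m (B - z%:M) = (d - z ^+ 2)%:M.
  by rewrite [RHS]raddfB /= -BB expr2 scalar_mxM mulmxBr !mulmxDl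
    (scalar_mxC z B) opprD addrA addrK.
have [dz|dz] := eqVneq d (z ^+ 2); last first.
  have Binj (y : 'cV_2) : (B - z%:M) *m y = 0 -> y = 0.
    move=> By; apply/eqP; suff : (d - z ^+ 2) *: y == 0.
      by rewrite scalemx_eq0 subr_eq0 (negPf dz).
    by rewrite -mul_scalar_mx -BzB -mulmxA By mulmx0.
  suff -> : x = 0 by rewrite !mulmx0.
  elim: r => [|r IHr] in Bx *; first exact: Binj.
  by apply: IHr; apply: Binj; rewrite mulmxA -[(B - _) *m _]exprS.
have BzBz : (B - z%:M) *m (B - z%:M) = (- z *+ 2) *: (B - z%:M).
  transitivity ((B + z%:M) *m (B - z%:M) + (- z *+ 2)%:M *m (B - z%:M)).
    rewrite -mulmxDl; congr (_ *m _).
    by rewrite raddfMn raddfN mulr2n /= addrA addrK.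
  by rewrite BzB dz subrr raddf0 add0r mul_scalar_mx.
have Bpow : (B - z%:M) ^+ r.+1 = (- z *+ 2) ^+ r *: (B - z%:M).
  elim: r {Bx} => [|r IHr]; first by rewrite scale1r.
  by rewrite exprS IHr -[LHS]scalemxAr BzBz scalerA -exprSr.
have [z0|z0] := eqVneq z 0.
  by rewrite mulmxA z0 raddf0 subr0 BB dz z0 expr0n /= raddf0 mul0mx.
move: Bx; rewrite Bpow -scalemxAl => /eqP.
rewrite scalemx_eq0 expf_eq0 mulrn_eq0 oppr_eq0 (negPf z0) andbF /=.
by move=> /eqP->; rewrite mulmx0.
Qed.

End TracelessBlock.

(** * Splitting a matrix into a square-zero and a diagonalizable part *)

Section Decomposition.
Variable F : closedFieldType.

(* Starting from the characteristic polynomial, the exponent of each factor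
   X - z can be lowered to the maximal rank of an eigenvector for z. *)
Lemma annihilator n (M : 'M[F]_n) :
    (forall z r (x : 'cV_n), gen_eigenvector M z r x -> r <> 1%N ->
      r = 2%N /\ z = 0) ->
  exists rs, [/\ uniq rs, 0 \notin rs & M *m M *m eval_roots rs M = 0].
Proof.
case: n M => [|n] M Mx; first by exists [::]; split=> //; rewrite thinmx0.
pose m z := if z == 0 :> F then 2%N else 1%N.
have le_m z r (x : 'cV_n.+1) : gen_eigenvector M z r x -> (r <= m z)%N.
  move=> Mzx; have [->|/eqP/(Mx _ _ _ Mzx)[-> ->]] := eqVneq r 1%N;
    last by rewrite /m eqxx.
  by rewrite /m; case: eqP.
have reduce z k h : horner_mx M (('X - z%:P) ^+ k * h) = 0 ->
    horner_mx M (('X - z%:P) ^+ m z * h) = 0.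
  rewrite !rmorphM !rmorphXn !rmorphB /= horner_mx_X horner_mx_C.
  exact: gen_eigenvector_le (le_m z) _ _ _.
pose s := [seq z <- spectrum M | z != 0]; exists (undup s); split.
- exact: undup_uniq.
- by rewrite mem_undup mem_filter eqxx.
(* The cofactor [g] is arbitrary so that each factor, once reduced, can be moved into it. *)
have reduce_all rs g (k : F -> nat) :
    horner_mx M ((\prod_(z <- rs) ('X - z%:P) ^+ k z) * g) = 0 ->
    horner_mx M ((\prod_(z <- rs) ('X - z%:P) ^+ m z) * g) = 0.
  elim: rs g => [|z rs IHrs] g; first by rewrite !big_nil.
  rewrite !big_cons -mulrA => /reduce; rewrite mulrCA => /IHrs.
  by rewrite mulrCA mulrA.
(* The root 0 is handled apart: its multiplicity [k], possibly 0, is replaced by 2 in every case. *)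
have [k s0] : exists k,
    \prod_(z <- spectrum M | z == 0) ('X - z%:P) = ('X - 0%:P) ^+ k.
  exists (count (pred1 0) (spectrum M)).
  rewrite (eq_bigr (fun=> 'X - 0%:P)) => [|z /eqP-> //].
  by rewrite big_const_seq iter_mulr_1.
have := Cayley_Hamilton M; rewrite spectrumE (bigID (pred1 0)) /= s0 mulrC.
rewrite -big_filter -/s -prodr_undup_exp_count /= => /reduce_all.
rewrite mulrC => /reduce.
rewrite /m eqxx rmorphM rmorphXn rmorphB /= horner_mx_X horner_mx_C raddf0
  subr0 expr2.
suff -> : \prod_(z <- undup s) ('X - z%:P) ^+ m z =
    \prod_(z <- undup s) ('X - z%:P).
  by rewrite -eval_rootsE.
apply: eq_big_seq => z; rewrite mem_undup mem_filter /m => /andP[/negPf-> _].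
by rewrite expr1.
Qed.

Lemma semisimple_off0_decomposition n (M : 'M[F]_n) :
    (forall z r (x : 'cV_n), gen_eigenvector M z r x -> r <> 1%N ->
      r = 2%N /\ z = 0) ->
  exists s t (D : 'M_t),
    hsim M (dirsum (jordan_mx (nseq s (2%N, 0))) D) /\ diagonalizable D.
Proof.
move=> /annihilator[rs [uniq_rs rs0 MMrs]].
have [s [t [D [MD D0]]]] := hsim_peel rs0 MMrs.
exists s, t, D; split=> //; apply: diagonalizable_eval_roots D0.
by rewrite /= rs0.
Qed.

End Decomposition.

(** * Antidiagonal matrices *)

Section Antidiagonal.
Variable F : fieldType.

(* Moves the first and last indices of ['I_n.+2] to the front. *)
Definition outer_first n (i : 'I_(2 + n)) : 'I_n.+2 :=
  inord (if i < 2 then i * n.+1 else i.-1)%N.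

Definition outer_back n (i : 'I_n.+2) : 'I_(2 + n) :=
  inord (if i == 0 :> nat then 0 else if i == n.+1 :> nat then 1 else i.+1)%N.

Lemma val_outer_first n (i : 'I_(2 + n)) :
  outer_first i = (if i < 2 then i * n.+1 else i.-1)%N :> nat.
Proof. by rewrite inordK //; have := ltn_ord i; case: ifP; nia. Qed.

Lemma val_outer_back n (i : 'I_n.+2) :
  outer_back i = (if i == 0 :> nat then 0 else if i == n.+1 :> nat then 1
    else i.+1)%N :> nat.
Proof. by rewrite inordK //; have := ltn_ord i; do 2?[case: eqP]; lia. Qed.

Lemma outer_firstK n : cancel (@outer_first n) (@outer_back n).
Proof.
move=> i; apply: val_inj; rewrite /= val_outer_back val_outer_first.
by have := ltn_ord i; case: (nat_of_ord i) => [|[|k]];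
  rewrite /= ?mul0n ?mul1n //; do 2?[case: eqP]; lia.
Qed.

Lemma outer_backK n : cancel (@outer_back n) (@outer_first n).
Proof.
move=> i; apply: val_inj; rewrite /= val_outer_first val_outer_back.
have := ltn_ord i; case: eqP => [->|]; first by rewrite mul0n.
case: eqP => [->|]; first by rewrite mul1n.
by case: ifP; lia.
Qed.

(** In the new order, reversal swaps the first two indices and acts on the other [n], shifted by 2,
    again as a reversal. *)
Lemma outer_first_rev n (i j : 'I_(2 + n)) :
  (outer_first j == rev_ord (outer_first i)) =
  (j == (if (i < 2)%N then 1 - i else n.+3 - i)%N :> nat).
Proof.
rewrite -val_eqE /= !val_outer_first; have := ltn_ord i; have := ltn_ord j.
case: (nat_of_ord i) => [|[|k]]; case: (nat_of_ord j) => [|[|l]];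
  rewrite /= ?mul0n ?mul1n; lia.
Qed.

(** Reversal preserves the set of the two outer indices, so the off-diagonal blocks vanish; it swaps
    them, so [B] has zero diagonal. *)
Lemma antidiagonal_outer_split n (A : 'M[F]_n.+2) : antidiagonal_mx A ->
  exists (B : 'M_2) (A' : 'M_n),
    [/\ \tr B = 0, antidiagonal_mx A' & hsim A (dirsum B A')].
Proof.
move=> adA; pose S := mxsub (@outer_first n) (@outer_first n) A.
have S0 (i j : 'I_(2 + n)) :
    j != (if (i < 2)%N then 1 - i else n.+3 - i)%N :> nat -> S i j = 0.
  rewrite -outer_first_rev mxE; apply: contraNeq => /adA ->; exact: eqxx.
exists (ulsubmx S), (drsubmx S); split.
- rewrite /mxtrace big1 // => i _; rewrite 2!mxE S0 //=.
  by have := ltn_ord i; case: ifP; lia.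
- move=> i j; rewrite 2!mxE; apply: contraNeq => ji; apply/eqP; apply: S0.
  move: ji; rewrite -val_eqE /=; have := ltn_ord i; have := ltn_ord j; lia.
- apply: hsim_trans (hsim_sym (hsim_mxsub A (@outer_firstK n)
    (@outer_backK n))) _.
  apply: eq_hsim; rewrite -[LHS]submxK /dirsum.
  congr block_mx; apply/matrixP=> i j.
    rewrite 2!mxE S0 ?mxE //=; have := ltn_ord i; have := ltn_ord j.
    by case: ifP; lia.
  rewrite 2!mxE S0 ?mxE //=; have := ltn_ord i; have := ltn_ord j; lia.
Qed.

Lemma antidiagonal_outer_merge n (B : 'M[F]_2) (A : 'M_n) :
    antidiagonal_mx B -> antidiagonal_mx A ->
  exists2 A' : 'M_n.+2, antidiagonal_mx A' & hsim (dirsum B A) A'.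
Proof.
move=> adB adA; exists (mxsub (@outer_back n) (@outer_back n) (dirsum B A));
  last first.
  exact/hsim_sym/hsim_mxsub/outer_firstK/outer_backK.
move=> a b; rewrite -[a]outer_backK -[b]outer_backK mxE !outer_firstK.
move: (outer_back a) (outer_back b) => {}a {}b Sab.
apply/eqP; rewrite outer_first_rev; move: Sab.
rewrite -(@splitK 2 n a) -(@splitK 2 n b).
case: (@split 2 n a) (@split 2 n b) => [i|i] [j|j]; rewrite /unsplit /dirsum
   ?(@block_mxEul _ 2 n 2 n, @block_mxEur _ 2 n 2 n,
     @block_mxEdl _ 2 n 2 n, @block_mxEdr _ 2 n 2 n).
- by move=> /adB ->; rewrite /= ltn_ord.
- by rewrite mxE eqxx.
- by rewrite mxE eqxx.
- by move=> /adA -> /=; have := ltn_ord i; lia.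
Qed.

(** Outer pairs of indices are removed two at a time. The size [odd n] of the remaining core [C]
    lets one statement cover both parities. *)
Lemma antidiagonal_traceless n (A : 'M[F]_n) : antidiagonal_mx A ->
  exists r (B : 'I_r -> 'M[F]_2) (C : 'M[F]_(odd n)),
    (forall i, \tr (B i) = 0) /\ hsim A (dirsum (\mxdiag_i B i) C).
Proof.
have [k] := ubnP n; elim: k n A => // k IHk [|[|n]] A lt_n adA.
- exists 0%N, (fun=> 0), 0; split=> [[]//|].
  by apply: hsim_empty; rewrite // big_ord0.
- exists 0%N, (fun=> 0), A; split=> [[]//|]; apply: hsim_sym.
  apply: hsim_trans (hsim_dirsum0l A 0); apply: hsim_dirsum (hsim_refl _).
  by apply: hsim_empty; rewrite // big_ord0.
rewrite /= negbK; have [B0 [A' [trB0 adA' AB0A']]] :=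
  antidiagonal_outer_split adA.
have [|r [B [C [trB A'BC]]]] := IHk n A' _ adA'; first by lia.
exists r.+1, (fun i => oapp B B0 (unlift ord0 i)), C; split=> [i|].
  by case: unliftP => [j|] _ /=.
apply: hsim_trans AB0A' _; apply: hsim_trans (hsim_dirsum (hsim_refl _) A'BC) _.
apply: hsim_trans (hsim_dirsumA _ _ _) _; apply: hsim_dirsum (hsim_refl _).
apply: hsim_sym; apply: hsim_trans (hsim_mxdiag_recl _) _.
apply: hsim_dirsum; first by rewrite unlift_none; apply: hsim_refl.
by apply: hsim_mxdiag => i; rewrite liftK; apply: hsim_refl.
Qed.

Lemma antidiagonal_le1 n (A : 'M[F]_n) : (n <= 1)%N -> antidiagonal_mx A.
Proof.
by case: n A => [|[|//]] A _ i j _; [case: i | rewrite [j]ord1 [RHS]ord1].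
Qed.

(** Starting with [C'] at the center, each block is wrapped as an outer pair around the antidiagonal
    matrix built so far. *)
Lemma antidiagonal_mxdiag r k m
    (B : 'I_r -> 'M[F]_2) (C : 'M[F]_m) (C' : 'M_k) :
    (forall i, exists2 A : 'M_2, antidiagonal_mx A & hsim (B i) A) ->
    antidiagonal_mx C' -> hsim C C' ->
  exists n (A : 'M_n), antidiagonal_mx A /\ hsim (dirsum (\mxdiag_i B i) C) A.
Proof.
move=> + adC' CC'; elim: r B => [|r IHr] B adB.
  exists k, C'; split=> //; apply: hsim_trans CC'.
  apply: hsim_trans (hsim_dirsum0l C 0); apply: hsim_dirsum (hsim_refl _).
  by apply: hsim_empty; rewrite // big_ord0.
have [n [A [adA BCA]]] := IHr (fun i => B (lift ord0 i)) (fun i => adB _).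
have [A0 adA0 BA0] := adB ord0.
have [A' adA' AA'] := antidiagonal_outer_merge adA0 adA.
exists n.+2, A'; split=> //; apply: hsim_trans AA'.
apply: hsim_trans (hsim_dirsum BA0 BCA).
apply: hsim_trans (hsim_dirsum (hsim_mxdiag_recl B) (hsim_refl C)) _.
exact/hsim_sym/hsim_dirsumA.
Qed.

End Antidiagonal.

(** * The equivalences *)

Section NormalForm.
Variable F : numClosedFieldType.
Implicit Types (lam zs ds : seq F).

Lemma if_c_symmetric n zs : odd (size zs) = odd n ->
  (if odd n then c_symmetric_spectrum zs else symmetric_spectrum zs) <->
  exists cs lam, size cs = odd n /\
    perm_eq zs (cs ++ lam ++ [seq - z | z <- lam]).
Proof.
move=> zsn; case: (odd n) zsn => zsn; split.
- by move=> /c_symmetric_spectrum_pairing[c [lam p]]; exists [:: c], lam.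
- case=> cs [lam [+ +]]; case: cs => [|c []] //= _ p.
  by rewrite perm_sym in p;
    apply: c_symmetric_spectrum_perm p (c_symmetric_spectrum_opp _ _).
- by move=> /symmetric_spectrum_pairing[lam]; rewrite zsn; exists [::], lam.
- case=> cs [lam [+ +]]; case: cs => //= _ p.
  by rewrite perm_sym in p;
    apply: symmetric_spectrum_perm p (symmetric_spectrum_opp _).
Qed.

Lemma spectrum_traceless_blocks r (B : 'I_r -> 'M[F]_2) m (C : 'M_m) :
    (forall i, \tr (B i) = 0) ->
  exists lam, perm_eq (spectrum (dirsum (\mxdiag_i B i) C))
                      (spectrum C ++ lam ++ [seq - z | z <- lam]).
Proof.
(* The characteristic polynomial ['X^2 + (\det (B i))%:P] factors as a difference of squares. *)
move=> trB; exists [seq sqrtC (- \det (B i)) | i <- enum 'I_r].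
apply: perm_spectrum; rewrite char_poly_dirsum char_poly_mxdiag spectrumE mulrC.
rewrite !big_cat /= -map_comp !big_map; congr (_ * _).
rewrite -big_split -enumT big_enum /=; apply: eq_bigr => i _.
rewrite char_poly_traceless // raddfN /= opprK -subr_sqr; congr (_ + _).
by rewrite -rmorphXn sqrtCK raddfN /= opprK.
Qed.

Definition jordan2 s : seq (nat * F) := nseq s (2%N, 0).
Definition jordan1 zs : seq (nat * F) := [seq (1%N, z) | z <- zs].

Lemma hsim_mxdiag_jordan2 s :
  hsim (\mxdiag_(i < s) (delta_mx 0 1 : 'M[F]_2)) (jordan_mx (jordan2 s)).
Proof.
have -> : jordan2 s = flatten [seq [:: (2%N, 0)] | i <- enum 'I_s].
  rewrite /jordan2 -[s in LHS]size_enum_ord.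
  by elim: (enum 'I_s) => //= i e ->.
apply: hsim_mxdiag_jordan => i; rewrite -jordan_block2.
exact: hsim_sym (hsim_jordan1 (2%N, 0)).
Qed.

Lemma tr_delta01 : \tr (delta_mx 0 1 : 'M[F]_2) = 0.
Proof. by rewrite /mxtrace !big_ord_recl big_ord0 !mxE !addr0. Qed.

Lemma sqr_jordan2 s : jordan_mx (jordan2 s) *m jordan_mx (jordan2 s) = 0.
Proof.
have sqr_hsim m n (A : 'M[F]_m) (B : 'M_n) : hsim A B -> B *m B = 0 ->
  A *m A = 0.
  case=> P [Q [PQ QP AP]] B0.
  by rewrite -[LHS]mulmx1 -PQ mulmxA -(mulmxA A) AP mulmxA AP -(mulmxA P) B0
    mulmx0 mul0mx.
elim: s => [|s IHs]; first exact: sqr_hsim (hsim_jordan_nil 0) (mulmx0 _ _).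
apply: sqr_hsim (hsim_jordan_cons _ _) _.
rewrite /dirsum mulmx_block IHs jordan_block2 mul_delta_mx_0 //.
by rewrite !(mul0mx, mulmx0) !addr0 -[RHS](block_mx0 _ _ _ _).
Qed.

Lemma hsim_sign_block (z : F) :
  hsim (z *: (delta_mx 0 0 - delta_mx 1 1) : 'M_2)
       (jordan_mx (jordan1 [:: z; - z])).
Proof.
have -> : z *: (delta_mx 0 0 - delta_mx 1 1) =
    diag_mx (\row_(j < 2) if j == 0 then z else - z).
  apply/matrixP=> [[[|[|[]]] //= ?] [[|[|[]]] //= ?]]; rewrite !mxE /=; ring.
have -> : jordan1 [:: z; - z] =
    [seq (1%N, (\row_(j < 2) (if j == 0 then z else - z)) 0 j)
       | j <- enum 'I_2].
  by rewrite !enum_ordSl enum_ord0 /= !mxE.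
exact: hsim_diag.
Qed.

Lemma hsim_sign_antidiagonal (z : F) :
  exists2 A : 'M_2, antidiagonal_mx A &
    hsim (z *: (delta_mx 0 0 - delta_mx 1 1) : 'M_2) A.
Proof.
exists (z *: (delta_mx 0 1 + delta_mx 1 0)) => [i j|].
  apply: contraNeq; case: i => [[|[|[]]] //= ?]; case: j => [[|[|[]]] //= ?] _;
  by rewrite !mxE /= ?addr0 mulr0.
have nz2 : 2%:R != 0 :> F by rewrite pnatr_eq0.
(* The columns (1, 1) and (1, -1) are eigenvectors of the exchange matrix; since [P] squares to 2,
   its inverse is half of itself. *)
pose P : 'M[F]_2 := \matrix_(i, j) (if (i == 1) && (j == 1) then -1 else 1).
have PP : P *m P = 2%:R%:M.
  by apply/matrixP=> [[[|[|[]]] //= ?] [[|[|[]]] //= ?]];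
    rewrite !mxE !big_ord_recl big_ord0 !mxE /=; ring.
exists P, (2%:R^-1 *: P).
rewrite -scalemxAr -scalemxAl PP scale_scalar_mx mulVf //; split=> //.
by apply/matrixP=> [[[|[|[]]] //= ?] [[|[|[]]] //= ?]];
    rewrite !mxE !big_ord_recl !big_ord0 !mxE /=; ring.
Qed.

Lemma hsim_sign_blocks (lam : seq F) r (l : 'I_r -> F) :
  lam = [seq l i | i <- enum 'I_r] ->
  hsim (\mxdiag_(i < r) (l i *: (delta_mx 0 0 - delta_mx 1 1) : 'M_2))
       (jordan_mx (jordan1 (lam ++ [seq - z | z <- lam]))).
Proof.
move=> ->.
apply: hsim_trans (hsim_mxdiag_jordan (fun i => hsim_sign_block (l i))) _.
(* The blocks list the eigenvalues in adjacent pairs [z, - z], whereas the target puts all the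
   opposites at the end. *)
apply: hsim_jordan_perm; elim: (enum 'I_r) => //= i e /permP IHe.
apply/permP=> p; move: (IHe p); rewrite /jordan1 !map_cat !count_cat /= => ->;
  rewrite count_cat; congr (_ + _)%N; exact: addnCA.
Qed.

Lemma size_jordan12 n (M : 'M[F]_n) s zs :
  hsim M (jordan_mx (jordan2 s ++ jordan1 zs)) -> n = (2 * s + size zs)%N.
Proof.
move=> /hsim_size ->; rewrite size_jordan map_cat sumn_cat map_nseq sumn_nseq.
by rewrite -map_comp (eq_map (_ : _ =1 fun=> 1%N)) // sumnE big_map sum1_size.
Qed.

Lemma spectrum_jordan2 s :
  perm_eq (spectrum (jordan_mx (jordan2 s))) (nseq (2 * s) 0).
Proof.
apply: perm_trans (spectrum_jordan _) _; rewrite mulnC.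
by elim: s => //= s IHs; rewrite !perm_cons.
Qed.

Lemma spectrum_jordan1 zs : perm_eq (spectrum (jordan_mx (jordan1 zs))) zs.
Proof.
apply: perm_trans (spectrum_jordan _) _.
by rewrite -map_comp flatten_map1 map_id.
Qed.

Lemma semisimple_off0_jordan2 s : semisimple_off0 (jordan_mx (jordan2 s)).
Proof.
apply: semisimple_off0_hsim (hsim_sym (hsim_mxdiag_jordan2 s)) _.
by apply: semisimple_off0_mxdiag => i;
  apply: semisimple_off0_traceless tr_delta01.
Qed.

(* [cs] is empty or a singleton, according to the parity of [n]. *)
Definition paired_jordan n (M : 'M[F]_n) : Prop :=
  exists s cs lam, size cs = odd n /\
    hsim M (jordan_mx
      (jordan2 s ++ jordan1 (cs ++ lam ++ [seq - z | z <- lam]))).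

Variables (n : nat) (M : 'M[F]_n).

(* The next five definitions are the conditions (b) to (f) of the theorem. *)

Definition traceless_blocks := exists (r : nat) (B : 'I_r -> 'M[F]_2),
  (forall i, \tr (B i) = 0) /\
  (if odd n then exists C : 'M_1, similar_mx M (dirsum (\mxdiag_(i < r) B i) C)
   else similar_mx M (\mxdiag_(i < r) B i)).

Definition spectral :=
  (if odd n then c_symmetric_spectrum (spectrum M)
   else symmetric_spectrum (spectrum M)) /\
  (forall (z : F) (r : nat) (x : 'cV_n),
     gen_eigenvector M z r x -> r <> 1%N -> r = 2%N /\ z = 0).

Definition nilpotent_diagonalizable :=
  exists (p q : nat) (N : 'M[F]_p) (D : 'M[F]_q),
    [/\ nilpotent_mx N /\
        (forall (z : F) (r : nat) (x : 'cV_p),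
           gen_eigenvector N z r x -> r <> 1%N -> r = 2%N),
        diagonalizable D,
        if odd n then c_symmetric_spectrum (spectrum D)
        else symmetric_spectrum (spectrum D)
      & similar_mx M (dirsum N D)].

Definition jordan_form :=
  exists (L : seq (nat * F)) (s r : nat) (lam : r.-tuple F),
    jordan_form_of M L /\
    (if odd n then
       n = (2 * s + 2 * r + 1)%N /\
       exists c : F,
         perm_eq L (nseq s (2%N, 0) ++
                    [seq (1%N, z) | z <- lam ++ c :: rev [seq - z | z <- lam]])
     else
       n = (2 * s + 2 * r)%N /\
       perm_eq L (nseq s (2%N, 0) ++
                  [seq (1%N, z) | z <- lam ++ rev [seq - z | z <- lam]])).

Definition sign_blocks := exists (s r : nat) (lam : 'I_r -> F),
  let N := \mxdiag_(i < s) (delta_mx 0 1 : 'M[F]_2) in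
  let D := \mxdiag_(i < r)
             (lam i *: (delta_mx 0 0 - delta_mx 1 1) : 'M[F]_2) in
  if odd n then exists c : F, similar_mx M (dirsum N (dirsum D (c%:M : 'M_1)))
  else similar_mx M (dirsum N D).

(** * The implications, in one cycle from (a) through (f) back to (a) *)

Lemma antidiagonalizable_traceless_blocks :
  antidiagonalizable M -> traceless_blocks.
Proof.
case=> A [/antidiagonal_traceless[r [B [C [trB ABC]]]] /similar_mxP MA].
have {ABC}MBC := hsim_trans MA ABC; exists r, B; split=> //.
case: (odd n) C MBC => C MBC; first by exists C; apply/similar_mxP.
by apply/similar_mxP; apply: hsim_trans MBC (hsim_dirsum0r _ _).
Qed.

Lemma traceless_blocks_spectral : traceless_blocks -> spectral.
Proof.
case=> r [B [trB MB]].
have [C MC] : exists C : 'M_(odd n), hsim M (dirsum (\mxdiag_i B i) C).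
  case: (odd n) MB => [[C /similar_mxP MB]|/similar_mxP MB]; first by exists C.
  by exists 0; apply: hsim_trans MB (hsim_sym (hsim_dirsum0r _ _)).
have ssC : semisimple_off0 C.
  case: (odd n) C {MC} => C.
    by rewrite [C]mx11_scalar; apply: semisimple_off0_scalar.
  by move=> z k x _; rewrite [x]flatmx0 !mulmx0.
split.
  apply/if_c_symmetric; first by rewrite size_spectrum.
  have [lam sp] := spectrum_traceless_blocks C trB.
  (* As [C] has size [odd n], its spectrum is exactly the unpaired part. *)
  by exists (spectrum C), lam; rewrite size_spectrum (spectrum_hsim MC).
move=> z k x; apply: gen_eigenvector_semisimple_off0.
apply: semisimple_off0_hsim MC _; apply: semisimple_off0_dirsum ssC.
by apply: semisimple_off0_mxdiag => i; apply: semisimple_off0_traceless.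
Qed.

Lemma spectral_nilpotent_diagonalizable : spectral -> nilpotent_diagonalizable.
Proof.
case=> symM /semisimple_off0_decomposition[s [t [D [MD diagD]]]].
exists _, t, (jordan_mx (jordan2 s)), D; split=> //; last exact/similar_mxP.
  split; first by exists 2%N; rewrite expr2; apply: sqr_jordan2.
  by move=> z r x Nx /(gen_eigenvector_semisimple_off0
    (@semisimple_off0_jordan2 s) Nx)[].
have spM : perm_eq (spectrum M) (nseq (2 * s) 0 ++ spectrum D).
  rewrite (spectrum_hsim MD); apply: perm_trans (spectrum_dirsum _ _) _.
  by rewrite perm_cat2r spectrum_jordan2.
case: (odd n) symM => symM.
  by apply: c_symmetric_spectrum_cat0 (c_symmetric_spectrum_perm spM symM);
    rewrite oddM.
apply/(symmetric_spectrum_cat _ (symmetric_spectrum0 F (2 * s))).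
exact: symmetric_spectrum_perm spM symM.
Qed.

Lemma nilpotent_diagonalizable_paired :
  nilpotent_diagonalizable -> paired_jordan M.
Proof.
case=> p [q [N [D [[[k Nk] N2] diagD symD /similar_mxP MND]]]].
(* Ranks are at most 2, so the kernel of every power of [N], in particular that of [N ^+ k = 0],
   lies in the kernel of its square. *)
have NN : N *m N = 0.
  have N2' r (x : 'cV_p) : gen_eigenvector N 0 r x -> (r <= 2)%N.
    by move=> Nx; have [->//|/eqP/(N2 _ _ _ Nx)->] := eqVneq r 1%N.
  have := gen_eigenvector_le N2' (_ : (N - 0%:M) ^+ k *m 1%:M = 0).
  by rewrite raddf0 subr0 Nk mul0mx mulmx1 expr2; apply.
(* With an empty list of roots, the remaining summand [Z] is annihilated by X alone, hence zero; its
   1x1 zero blocks join the diagonal part. *)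
have [|s [t [Z [NZ]]]] := @hsim_peel _ [::] p N isT; first by rewrite /= mulmx1.
rewrite /= mulmx1 raddf0 subr0 => Z0; subst Z.
have [ds Dds] := hsim_diagonalizable diagD.
have [zs0 Zzs0] : exists k, hsim (0 : 'M[F]_t) (jordan_mx (jordan1 (nseq k 0))).
  exists (size (enum 'I_t)); have := hsim_diag (0 : 'rV[F]_t); rewrite raddf0.
  suff -> : [seq (1%N, (0 : 'rV[F]_t) 0 i) | i <- enum 'I_t] =
      jordan1 (nseq (size (enum 'I_t)) 0) by [].
  by elim: (enum 'I_t) => //= i e ->; rewrite mxE.
have MJ : hsim M (jordan_mx (jordan2 s ++ jordan1 (nseq zs0 0 ++ ds))).
  rewrite /jordan1 map_cat catA.
  apply: hsim_trans MND _; apply: hsim_trans _ (hsim_sym (hsim_jordan_cat _ _)).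
  apply: hsim_dirsum Dds; apply: hsim_trans NZ _.
  apply: hsim_trans _ (hsim_sym (hsim_jordan_cat _ _)).
  exact: hsim_dirsum (hsim_refl _) Zzs0.
have [szM symds] : n = (2 * s + size (nseq zs0 0%R ++ ds))%N /\
    (if odd n then c_symmetric_spectrum ds else symmetric_spectrum ds).
  split; first exact: size_jordan12 MJ.
  have Dsp := spectrum_jordan1 ds; rewrite -(spectrum_hsim Dds) in Dsp.
  case: (odd n) symD => symD; first exact: c_symmetric_spectrum_perm Dsp symD.
  exact: symmetric_spectrum_perm Dsp symD.
have szn : odd (size (nseq zs0 0 ++ ds)) = odd n.
  by rewrite [in RHS]szM oddD oddM.
suff /(if_c_symmetric szn)[cs [lam [szcs /(perm_map (fun z => (1%N, z)))zsp]]] :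
    if odd n then c_symmetric_spectrum (nseq zs0 0 ++ ds)
    else symmetric_spectrum (nseq zs0 0 ++ ds).
  exists s, cs, lam; split=> //; apply: hsim_trans MJ _.
  by apply: hsim_jordan_perm; rewrite perm_cat2l.
case: (odd n) szn symds => szn symds; last first.
  exact/(symmetric_spectrum_cat _ (symmetric_spectrum0 F zs0)).
(* Both [ds] and the whole diagonal part have odd size, so the zeros coming from [N] are even in
   number and can be paired. *)
have odd0 : odd zs0 = false.
  by have [odds _] := symds; move: szn; rewrite size_cat size_nseq oddD odds;
    case: odd.
apply: c_symmetric_spectrum_cat symds; last exact: symmetric_spectrum0.
by rewrite size_nseq odd0.
Qed.

Lemma paired_jordan_form : paired_jordan M -> jordan_form.
Proof.
case=> s [cs [lam [szcs MJ]]]; have szM := size_jordan12 MJ.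
rewrite !size_cat size_map in szM.
exists (jordan2 s ++ jordan1 (cs ++ lam ++ [seq - z | z <- lam])), s,
  (size lam), (in_tuple lam).
split.
  split; last exact/similar_mxP.
  by rewrite all_cat all_nseq orbT all_map; apply/allP.
have perm_lam u : perm_eq (lam ++ u ++ [seq - z | z <- lam])
    (lam ++ u ++ rev [seq - z | z <- lam]).
  by rewrite !perm_cat2l perm_sym perm_rev.
case: (odd n) szcs => szcs; rewrite szcs /= in szM; split.
- by rewrite szM mul2n -addnn; lia.
- case: cs szcs {MJ szM} => [|c []] // _; exists c.
  rewrite perm_cat2l; apply: perm_map; rewrite -cat1s -[c :: rev _]cat1s.
  by apply: perm_trans (perm_lam [:: c]); rewrite perm_catCA.
- by rewrite szM; lia.
- case: cs szcs {MJ szM} => //= _; rewrite perm_cat2l; apply: perm_map.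
  exact: perm_lam [::].
Qed.

Lemma jordan_form_sign_blocks : jordan_form -> sign_blocks.
Proof.
case=> L [s [r [lam [[_ /similar_mxP ML] H]]]].
exists s, r, (tnth lam); rewrite /=.
have lamE : lam = [seq tnth lam i | i <- enum 'I_r] :> seq F.
  by rewrite map_tnth_enum.
have sign := hsim_sign_blocks lamE.
have N2 := hsim_mxdiag_jordan2 s.
have rev_lam u : perm_eq (jordan1 (lam ++ u ++ rev [seq - z | z <- lam]))
    (jordan1 ((lam ++ [seq - z | z <- lam]) ++ u)).
  by apply: perm_map; rewrite -catA perm_cat2l perm_catC perm_cat2r perm_rev.
case: (odd n) H => -[_].
  case=> c /hsim_jordan_perm Lc; exists c; apply/similar_mxP.
  apply: hsim_trans ML (hsim_trans Lc (hsim_trans (hsim_jordan_cat _ _) _)).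
  apply: hsim_dirsum (hsim_sym N2) _.
  apply: hsim_trans (hsim_jordan_perm (rev_lam [:: c])) _.
  rewrite /jordan1 map_cat; apply: hsim_trans (hsim_jordan_cat _ _) _.
  apply: hsim_dirsum (hsim_sym sign) _.
  by rewrite -jordan_block1; apply: hsim_jordan1.
move=> /hsim_jordan_perm Lc; apply/similar_mxP.
apply: hsim_trans ML (hsim_trans Lc (hsim_trans (hsim_jordan_cat _ _) _)).
apply: hsim_dirsum (hsim_sym N2) _.
apply: hsim_trans (hsim_jordan_perm (rev_lam [::])) _.
by rewrite cats0; apply: hsim_sym.
Qed.

Lemma sign_blocks_antidiagonalizable : sign_blocks -> antidiagonalizable M.
Proof.
case=> s [r [lam /= H]].
set N := mxdiag _ in H; set D := mxdiag _ in H.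
have [k [C [k1 MNDC]]] : exists k (C : 'M[F]_k),
    (k <= 1)%N /\ hsim M (dirsum N (dirsum D C)).
  case: (odd n) H => [[c /similar_mxP MC]|/similar_mxP MND];
    first by exists 1%N, c%:M.
  exists 0%N, 0; split=> //; apply: hsim_trans MND _.
  exact: hsim_dirsum (hsim_refl _) (hsim_sym (hsim_dirsum0r _ _)).
have [m [A [adA DCA]]] :=
  antidiagonal_mxdiag (fun i => hsim_sign_antidiagonal (lam i))
  (antidiagonal_le1 (A := C) k1) (hsim_refl C).
have adJ : antidiagonal_mx (delta_mx 0 1 : 'M[F]_2).
  by move=> i j; apply: contraNeq; case: i => [[|[|[]]] //= ?];
    case: j => [[|[|[]]] //= ?] _;
    rewrite !mxE.
(* The nilpotent blocks, already antidiagonal, are wrapped around the antidiagonal form [A] of the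
   rest. *)
have [m' [A' [adA' NA']]] :=
  @antidiagonal_mxdiag _ s _ _ (fun=> delta_mx 0 1) _ _
  (fun=> ex_intro2 _ _ _ adJ (hsim_refl _)) adA DCA.
have {}MA' := hsim_trans MNDC NA'; have em := hsim_size MA'; subst m'.
by exists A'; split=> //; apply/similar_mxP.
Qed.

End NormalForm.

Theorem corollary5p9 (R : realType) (n : nat) (M : 'M[R[i]]_n) :
  [<->
   (* (a) *)
     antidiagonalizable M;
   (* (b) *)
     exists (r : nat) (B : 'I_r -> 'M[R[i]]_2),
       (forall i, \tr (B i) = 0) /\
       (if odd n then
          exists C : 'M[R[i]]_1, similar_mx M (dirsum (\mxdiag_(i < r) B i) C)
        else similar_mx M (\mxdiag_(i < r) B i));
   (* (c) *)
     (if odd n then c_symmetric_spectrum (spectrum M)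
      else symmetric_spectrum (spectrum M)) /\
     (forall (z : R[i]) (r : nat) (x : 'cV[R[i]]_n),
        gen_eigenvector M z r x -> r <> 1%N -> r = 2%N /\ z = 0);
   (* (d) *)
     exists (p q : nat) (N : 'M[R[i]]_p) (D : 'M[R[i]]_q),
       [/\ nilpotent_mx N /\
           (forall (z : R[i]) (r : nat) (x : 'cV[R[i]]_p),
              gen_eigenvector N z r x -> r <> 1%N -> r = 2%N),
           diagonalizable D,
           if odd n then c_symmetric_spectrum (spectrum D)
           else symmetric_spectrum (spectrum D)
         & similar_mx M (dirsum N D)];
   (* (e) *)
     exists (L : seq (nat * R[i])) (s r : nat) (lam : r.-tuple R[i]),
       jordan_form_of M L /\
       (if odd n then
          n = (2 * s + 2 * r + 1)%N /\
          exists c : R[i],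
            perm_eq L (nseq s (2%N, 0) ++
                       [seq (1%N, z) | z <- lam ++ c :: rev [seq - z | z <- lam]])
        else
          n = (2 * s + 2 * r)%N /\
          perm_eq L (nseq s (2%N, 0) ++
                     [seq (1%N, z) | z <- lam ++ rev [seq - z | z <- lam]]));
   (* (f) *)
     exists (s r : nat) (lam : 'I_r -> R[i]),
       let N := \mxdiag_(i < s) (delta_mx 0 1 : 'M[R[i]]_2) in
       let D := \mxdiag_(i < r)
                  (lam i *: (delta_mx 0 0 - delta_mx 1 1) : 'M[R[i]]_2) in
       if odd n then
         exists c : R[i], similar_mx M (dirsum N (dirsum D (c%:M : 'M_1)))
       else similar_mx M (dirsum N D)].
Proof.
tfae.
- exact: antidiagonalizable_traceless_blocks.
- exact: traceless_blocks_spectral.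
- exact: spectral_nilpotent_diagonalizable.
- by move=> /nilpotent_diagonalizable_paired/paired_jordan_form.
- exact: jordan_form_sign_blocks.
- exact: sign_blocks_antidiagonalizable.
Qed.
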